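(* There is an absolute constant $c>0$ such that for all integers $n>1$ and $1<k\le\binom{n-1}{\lfloor(n-1)/2\rfloor}$: $C_{\mathrm{NSW}}(n,k)\ge(cnk)^n$ and $D_{\mathrm{NGBW}\to\mathrm{DRW}}(n,k)\ge(cnk)^n$.
   Context: All automata have a finite alphabet $\Sigma$, finite state set $S$, initial states $I\subseteq S$, transitions $\Delta\subseteq S\times\Sigma\times S$; a run over $\alpha\in\Sigma^\omega$ is $\rho(0)\rho(1)\cdots$ with $\rho(0)\in I$, $\langle\rho(i),\alpha(i),\rho(i+1)\rangle\in\Delta$, and $Inf(\rho)$ is the set of states occurring infinitely often; $\alpha$ is accepted if some run is successful. An NGBW has acceptance $\{F_1,\dots,F_k\}$ (successful iff $Inf(\rho)\cap F_i\neq\emptyset$ for all $i$). An NSW (Streett) has acceptance $\{\langle G_1,B_1\rangle,\dots,\langle G_k,B_k\rangle\}$ (successful iff for all $i$, $Inf(\rho)\cap B_i\ne\emptyset$ implies $Inf(\rho)\cap G_i\ne\emptyset$). A Rabin automaton has acceptance of the same form (successful iff for some $i$, $Inf(\rho)\cap G_i\ne\emptyset$ and $Inf(\rho)\cap B_i=\emptyset$); a DRW is a deterministic Rabin automaton, i.e. $|I|=1$ and for each $p,a$ at most one $q$ with $\langle p,a,q\rangle\in\Delta$. In each case $k$ is the index. $C_{\mathrm{NSW}}(n,k)$ is the maximum, over NSWs $\mathcal{A}$ with $n$ states and index $k$, of the minimum number of states of an NSW accepting $\Sigma^\omega\setminus\mathcal{L}(\mathcal{A})$. $D_{\mathrm{NGBW}\to\mathrm{DRW}}(n,k)$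 is the maximum, over NGBWs $\mathcal{A}$ with $n$ states and index $k$, of the minimum number of states of a DRW accepting $\mathcal{L}(\mathcal{A})$. *)

(* Defs.v *)
From mathcomp Require Import all_boot all_order all_algebra.
From mathcomp Require Import boolp classical_sets reals constructive_ereal ereal.

Set Implicit Arguments.
Unset Strict Implicit.
Unset Printing Implicit Defensive.

Import Order.TTheory GRing.Theory Num.Theory.

Local Open Scope classical_set_scope.
Local Open Scope ring_scope.

Record automaton (Sigma : finType) := Automaton {
  state : finType;
  init : {set state};
  trans : {set state * Sigma * state} }.

Definition is_run (Sigma : finType) (A : automaton Sigma)
    (alpha : nat -> Sigma) (rho : nat -> state A) : Prop :=
  rho 0%N \in init A /\
  forall i : nat, (rho i, alpha i, rho i.+1) \in trans A.

Definition Inf (S : Type) (rho : nat -> S) : set S :=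
  [set q | forall i : nat, exists2 j : nat, (i <= j)%N & rho j = q].

(* The language of A when a run is successful iff its set of infinitely
   recurring states satisfies [success]. *)
Definition accepted (Sigma : finType) (A : automaton Sigma)
    (success : set (state A) -> Prop) : set (nat -> Sigma) :=
  [set alpha | exists2 rho : nat -> state A,
     is_run alpha rho & success (Inf rho)].

(* Acceptance conditions are finite sets, not lists: the index counts distinct
   members. *)
Record NGBW (Sigma : finType) := MkNGBW {
  ngbw_aut :> automaton Sigma;
  ngbw_acc : {set {set state ngbw_aut}} }.

Definition ngbw_lang (Sigma : finType) (A : NGBW Sigma) : set (nat -> Sigma) :=
  accepted (fun X : set (state A) =>
    forall F : {set state A}, F \in ngbw_acc A -> X `&` [set` F] !=set0).

(* In all pairs below the first component is G and the second is B. *)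
Record NSW (Sigma : finType) := MkNSW {
  nsw_aut :> automaton Sigma;
  nsw_acc : {set {set state nsw_aut} * {set state nsw_aut}} }.

Definition nsw_lang (Sigma : finType) (A : NSW Sigma) : set (nat -> Sigma) :=
  accepted (fun X : set (state A) =>
    forall G B : {set state A}, (G, B) \in nsw_acc A ->
      X `&` [set` B] !=set0 -> X `&` [set` G] !=set0).

Definition deterministic (Sigma : finType) (A : automaton Sigma) : Prop :=
  #|init A| = 1%N /\
  forall (p : state A) (a : Sigma) (q q' : state A),
    (p, a, q) \in trans A -> (p, a, q') \in trans A -> q = q'.

Record DRW (Sigma : finType) := MkDRW {
  drw_aut :> automaton Sigma;
  drw_acc : {set {set state drw_aut} * {set state drw_aut}};
  drw_det : deterministic drw_aut }.

Definition drw_lang (Sigma : finType) (A : DRW Sigma) : set (nat -> Sigma) :=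
  accepted (fun X : set (state A) =>
    exists G B : {set state A},
      [/\ (G, B) \in drw_acc A, X `&` [set` G] !=set0
        & X `&` [set` B] = set0]).

(* Minima and maxima of state counts are taken as inf and sup in \bar R. A
   nonempty set of natural numbers attains its inf, and attains its sup when
   that is finite; the inf over an empty family is +oo. *)
Definition min_nsw_states (R : realType) (Sigma : finType)
    (L : set (nat -> Sigma)) : \bar R :=
  ereal_inf [set x | exists B : NSW Sigma,
    nsw_lang B = L /\ x = (#|state B|%:R)%:E].

Definition min_drw_states (R : realType) (Sigma : finType)
    (L : set (nat -> Sigma)) : \bar R :=
  ereal_inf [set x | exists B : DRW Sigma,
    drw_lang B = L /\ x = (#|state B|%:R)%:E].

Definition C_NSW (R : realType) (n k : nat) : \bar R :=
  ereal_sup [set x | exists (Sigma : finType) (A : NSW Sigma),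
    [/\ #|state A| = n, #|nsw_acc A| = k
      & x = min_nsw_states R (~` nsw_lang A)]].

Definition D_NGBW_DRW (R : realType) (n k : nat) : \bar R :=
  ereal_sup [set x | exists (Sigma : finType) (A : NGBW Sigma),
    [/\ #|state A| = n, #|ngbw_acc A| = k
      & x = min_drw_states R (ngbw_lang A)]].

(* Main.v *)
(* Write N = n - 1. The automaton has N tracks and one spare state; its letters
   are arbitrary relations, and its acceptance sets are k subsets of the tracks
   of size N/2, hence an antichain, chosen so that every track lies outside at
   least k/4 of them. To a permutation sigma of the tracks and a choice, for
   every track p, of an acceptance set F_p avoiding p, attach a finite word
   along which a run at p may either stay at p, visiting exactly the tracks
   outside F_p, hence meeting every acceptance set but F_p, or leave for a track
   of smaller sigma-rank after visiting an element of F_p. The omega-power of one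
   such word is rejected. Two distinct ones mixed are accepted: if the choices
   differ at p, stay at p; otherwise two tracks are ordered oppositely by the two
   permutations, so a run can alternate between them. By Michel's splicing
   argument every Streett automaton for the complement, and every deterministic
   Rabin automaton for the language, has at least N! (k/4)^N states. *)
Require Import Defs.
From mathcomp Require Import all_boot all_order all_algebra.
From mathcomp Require Import boolp classical_sets reals constructive_ereal ereal.
From mathcomp Require Import perm zify.

Set Implicit Arguments.
Unset Strict Implicit.
Unset Printing Implicit Defensive.

(** * Ultimately periodic words and Michel's splicing argument *)

Section Lasso.
Variable T : Type.
Implicit Types (u v : seq T) (x : T).

(** The word [u v^omega]; the default [x] is read only when [v] is empty. *)
Definition lasso x u v (t : nat) : T :=
  if t < size u then nth x u t else nth x v ((t - size u) %% size v).

Lemma lasso_consS x a u v t : lasso x (a :: u) v t.+1 = lasso x u v t.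
Proof. by rewrite /lasso /= ltnS subSS. Qed.

Lemma lasso_nil x v t : lasso x [::] v t = lasso x v v t.
Proof.
rewrite /lasso ltn0 subn0; case: ltnP => [lt_tv|le_vt]; first by rewrite modn_small.
by rewrite -{1}(subnK le_vt) modnDr.
Qed.

Lemma lasso_cat x u u' v t :
  lasso x (u ++ u') v t =
  if t < size u then nth x u t else lasso x u' v (t - size u).
Proof.
rewrite /lasso size_cat nth_cat; case: (ltnP t (size u)) => [h|h].
  by rewrite ltn_addr.
by rewrite subnDA ltn_subLR.
Qed.

Lemma lasso_rep x u v t m : t < m * size v -> 
  lasso x (flatten (nseq m v)) u t = lasso x [::] v t.
Proof.
elim: m t => [|m IHm] t; first by rewrite mul0n.
rewrite mulSn /= lasso_cat lasso_nil.
have -> : lasso x v v t = lasso x (v ++ [::]) v t by rewrite cats0.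
rewrite lasso_cat.
by case: (ltnP t (size v)) => // le_vt lt_t; rewrite IHm // ltn_subLR.
Qed.

Lemma lasso_fold x v t m : lasso x [::] v (m * size v + t) = lasso x [::] v t.
Proof. by rewrite /lasso !ltn0 !subn0 modnMDl. Qed.

Lemma map_lasso_rep x v s m :
  [seq lasso x [::] v t | t <- iota (s * size v) (m * size v)]
  = flatten (nseq m v).
Proof.
elim: m s => [|m IHm] s; first by rewrite mul0n.
rewrite mulSn iotaD map_cat -mulSnr IHm /=; congr (_ ++ _).
rewrite -[s * _]addn0 iotaDl -map_comp; apply: (@eq_from_nth _ x).
  by rewrite size_map size_iota.
rewrite size_map size_iota => i lt_iv.
rewrite (nth_map 0) ?size_iota // nth_iota //= lasso_fold.
by rewrite lasso_nil /lasso lt_iv.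
Qed.

Lemma lasso_tail x u v t : size u <= t -> 0 < size v ->
  exists2 i, i < size v & lasso x u v t = nth x v i.
Proof.
move=> le_ut v_gt0; exists ((t - size u) %% size v); first by rewrite ltn_mod.
by rewrite /lasso ltnNge le_ut.
Qed.

Lemma lasso_recur x u v i m : i < size v ->
  lasso x u v (size u + (m * size v + i)) = nth x v i.
Proof.
by move=> lt_iv; rewrite /lasso ltnNge leq_addr addKn modnMDl modn_small.
Qed.

End Lasso.

(** * Finite runs, and infinite runs built from a loop *)

Section Paths.
Variables (Sigma : finType) (A : automaton Sigma).
Implicit Types (x y : state A) (w : seq Sigma) (r : seq (state A)).

(* [r] lists the states after [x] of a finite run on [w] from [x]. *)
Fixpoint fits x w r : bool :=
  match w, r with
  | a :: w', y :: r' => ((x, a, y) \in trans A) && fits y w' r'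
  | [::], [::] => true
  | _, _ => false
  end.

Lemma fits_size x w r : fits x w r -> size r = size w.
Proof. by elim: w x r => [|a w IHw] x [|y r] //= /andP[_ /IHw->]. Qed.

Lemma fits_cat x w1 w2 r1 r2 :
  fits x w1 r1 -> fits (last x r1) w2 r2 -> fits x (w1 ++ w2) (r1 ++ r2).
Proof.
by elim: w1 x r1 => [|a w IHw] x [|y r] //= /andP[-> /IHw h] /h.
Qed.

Lemma fits_run (alpha : nat -> Sigma) rho s m : is_run alpha rho ->
  fits (rho s) [seq alpha t | t <- iota s m] [seq rho t | t <- iota s.+1 m].
Proof.
by case=> _ step; elim: m s => [|m IHm] s //=; rewrite step IHm.
Qed.

Lemma last_run (rho : nat -> state A) s m :
  last (rho s) [seq rho t | t <- iota s.+1 m] = rho (s + m).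
Proof. by elim: m s => [|m IHm] s /=; rewrite ?addn0 // IHm addSnnS. Qed.

Lemma lasso_run a0 x q u v r1 r2 :
  x \in init A -> fits x u r1 -> last x r1 = q ->
  0 < size v -> fits q v r2 -> last q r2 = q ->
  exists2 rho, is_run (lasso a0 u v) rho & Inf rho = [set` r2]%classic.
Proof.
move=> init_x fit1 last1 v_gt0 fit2 last2.
have szr2 := fits_size fit2.
pose rho t := if t is t'.+1 then lasso q r1 r2 t' else x.
(* The claim covers any remaining prefix; once it is exhausted, a fresh copy of the loop becomes the
   prefix. *)
have step t y w r : fits y w r -> last y r = q ->
    ((if t is t'.+1 then lasso q r r2 t' else y), lasso a0 w v t,
     lasso q r r2 t) \in trans A.
  elim: t y w r => [|t IHt] y w r.
    case: w r => [|a w] [|z r] //=; last by case/andP.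
    move=> _ ->; rewrite !lasso_nil; case: (v) (r2) fit2 v_gt0 => [|a w] [|z r] //=.
    by case/andP.
  case: w r => [|a w] [|z r] //=; last first.
    case/andP=> _ fit_z last_z; rewrite !lasso_consS.
    have := IHt _ _ _ fit_z last_z; by case: t {IHt}.
  move=> _ eq_yq; rewrite !lasso_nil.
  case: (v) (r2) fit2 v_gt0 last2 IHt => [|a w] [|z r] //= /andP[_ fit_z] _ last_z IHt.
  rewrite !lasso_consS; have := IHt _ _ _ fit_z last_z.
  by case: t {IHt} => [|t] //=; rewrite ?lasso_consS.
exists rho; first by split=> // t; apply: step.
apply/seteqP; split=> y /=.
  move=> /(_ (size r1).+1)[[|j] // le_j <-] /=.
  have r2_gt0 : 0 < size r2 by rewrite szr2.
  by have [i lt_i ->] := lasso_tail q le_j r2_gt0; rewrite mem_nth.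
move=> y_r2 i.
exists (size r1 + (i * size r2 + index y r2)).+1.
  have: i * 1 <= i * size r2 by rewrite leq_mul2l szr2 v_gt0 orbT.
  lia.
by rewrite /= lasso_recur ?index_mem ?nth_index.
Qed.

End Paths.

(** * Recurring states of infinite runs *)

Lemma eventually_fin (S : finType) (P : S -> nat -> Prop) :
  (forall x, exists i, forall j, i <= j -> P x j) ->
  exists i, forall x j, i <= j -> P x j.
Proof.
move=> /choice[F hF]; exists (\max_x F x) => x j le_j.
by apply: hF; apply: leq_trans le_j; apply: leq_bigmax.
Qed.

Lemma notin_Inf (S : Type) (rho : nat -> S) x :
  ~ Inf rho x -> exists i, forall j, i <= j -> rho j <> x.
Proof.
move=> /existsNP[i hi]; exists i => j le_ij rx.
by apply: hi; exists j.
Qed.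

Lemma Inf_neq0 (S : finType) (rho : nat -> S) : exists q, Inf rho q.
Proof.
apply: contrapT => /forallNP noq.
have [i hi] := @eventually_fin S (fun q j => rho j <> q) (fun q => notin_Inf (noq q)).
exact: (hi (rho i) i).
Qed.

(** By pigeonhole some [q] recurs at period boundaries. Cut at a visit of [q] after which only
    recurring states occur, and again once all of them have been seen: the loop in between visits
    exactly [Inf rho]. *)
Lemma run_loop (Sigma : finType) (A : automaton Sigma) a0 (w : seq Sigma) rho :
  0 < size w -> is_run (lasso a0 [::] w) rho ->
  exists q : state A,
    (exists m x r, [/\ x \in init A, fits x (flatten (nseq m w)) r & last x r = q]) /\
    (exists m r, [/\ fits q (flatten (nseq m.+1 w)) r, last q r = q
      & Inf rho = [set` r]%classic]).
Proof.
move=> w_gt0 runP; have [rho0 _] := runP.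
have [q qinf] := Inf_neq0 (fun m => rho (m * size w)).
have [T hT] : exists T, forall x j, T <= j -> ~ Inf rho x -> rho j <> x.
  apply: eventually_fin => x; have [Ix|nIx] := pselect (Inf rho x); first by exists 0.
  by have [i hi] := notin_Inf nIx; exists i => j /hi.
have [m1 le_m1 qm1] := qinf T.
have [J hJ] : exists J, forall x j, J <= j -> Inf rho x ->
    exists2 i, m1 * size w < i <= j & rho i = x.
  apply: eventually_fin => x; have [Ix|nIx] := pselect (Inf rho x); last first.
    by exists 0.
  have [i le_i xi] := Ix (m1 * size w).+1.
  by exists i => j le_j _; exists i; rewrite // le_i.
have [m2 le_m2 qm2] := qinf (maxn J m1.+1).
move: le_m2; rewrite geq_max => /andP[leJ le_m2].
have leT m : m <= m * size w by rewrite leq_pmulr.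
exists q; split.
  exists m1, (rho 0), [seq rho t | t <- iota 1 (m1 * size w)].
  split=> //; last by rewrite last_run add0n.
  by rewrite -(map_lasso_rep a0 w 0); apply: fits_run.
exists (m2 - m1.+1), [seq rho t | t <- iota (m1 * size w).+1 ((m2 - m1) * size w)].
have e12 : m1 * size w + (m2 - m1) * size w = m2 * size w.
  by rewrite -mulnDl subnKC // ltnW.
rewrite subnSK //; split.
- by rewrite -(map_lasso_rep a0 w m1) -{1}qm1; apply: fits_run.
- by rewrite -[in last q]qm1 last_run e12.
- apply/seteqP; split=> x /=.
    move=> /(hJ x (m2 * size w) (leq_trans leJ (leT _)))[i /andP[lt_i le_i] <-].
    by apply: map_f; rewrite mem_iota lt_i /= addSn e12 ltnS.
  move=> /mapP[j]; rewrite mem_iota => /andP[lt_j _] ->.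
  apply: contrapT => /(hT (rho j) j); apply=> //.
  by apply: leq_trans (ltnW lt_j); apply: leq_trans (leT _).
Qed.

(* Michel's argument: a state recurring between periods in successful runs on
   both [w i]^omega and [w j]^omega would let the two loops be spliced, and
   success is preserved by union. *)
Lemma fooling_set (Sigma : finType) (A : automaton Sigma)
    (success : set (state A) -> Prop) (I : finType) a0 (w : I -> seq Sigma) :
  (forall i, 0 < size (w i)) ->
  (forall X Y, success X -> success Y -> success (X `|` Y)%classic) ->
  (forall i, accepted success (lasso a0 [::] (w i))) ->
  (forall i j m a b, i != j -> ~ accepted success
     (lasso a0 (flatten (nseq m (w i)))
       (flatten (nseq a.+1 (w i)) ++ flatten (nseq b.+1 (w j))))) ->
  #|I| <= #|state A|.
Proof.
move=> w_gt0 successU acc nacc.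
pose good i q :=
  (exists m x r, [/\ x \in init A, fits x (flatten (nseq m (w i))) r & last x r = q]) /\
  (exists m r, [/\ fits q (flatten (nseq m.+1 (w i))) r, last q r = q
      & success [set` r]%classic]).
have /choice[f hf] i : exists q, good i q.
  have [rho runP succP] := acc i.
  have [q [pre [m [r [h1 h2 h3]]]]] := run_loop (w_gt0 i) runP.
  by exists q; split=> //; exists m, r; rewrite -h3.
suff: injective f by apply: leq_card.
move=> i j fij; apply/eqP/negP => /negP neq_ij.
have [[m [x [r1 [init_x fit1 last1]]]] [a [ra [fita lasta sa]]]] := hf i.
have [_ [b [rb [fitb lastb sb]]]] := hf j.
apply: (nacc i j m a b neq_ij).
have [|||rho runP infP] := @lasso_run _ A a0 x (f i) (flatten (nseq m (w i)))
  (flatten (nseq a.+1 (w i)) ++ flatten (nseq b.+1 (w j))) r1 (ra ++ rb) init_x fit1 last1.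
- by rewrite !size_cat addn_gt0 addn_gt0 w_gt0.
- by apply: fits_cat => //; rewrite lasta fij.
- by rewrite last_cat lasta fij.
exists rho => //; rewrite infP.
have -> : [set` ra ++ rb]%classic = ([set` ra] `|` [set` rb])%classic.
  apply/seteqP; split=> y /=; rewrite mem_cat; first by move/orP.
  by move=> h; apply/orP.
exact: successU.
Qed.

(** * The hard generalized Buchi automaton *)

Section Words.
Variable N : nat.
Notation track := 'I_N.
Notation letter := {set option track * option track}.
Implicit Types (p q s x y : track) (f g : 'S_N * {ffun track -> {set track}}).

(** A letter is its own transition relation, so the word alone dictates the possible moves. All
    states are initial, so a run may begin at any track. *)
Definition full_automaton : automaton letter :=
  @Automaton letter (option track) [set: option track]
    [set e : option track * letter * option track | (e.1.1, e.2) \in e.1.2].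

(* A run at [p] may visit [s], whose own run steps aside to the spare state
   [None]. *)
Definition detour p s : letter :=
  [set e | match e.1 with
     | Some x => if x == p then (e.2 == Some p) || (e.2 == Some s)
                 else if x == s then e.2 == None else e.2 == Some x
     | None => false
     end].

(** The run visiting [s] moves on to [Q], while the run that made room in [None] gets [s] back. *)
Definition return_to s (Q : {set track}) : letter :=
  [set e | match e.1 with
     | Some x => if x == s then e.2 \in [set Some y | y in Q]
                 else e.2 == Some x
     | None => e.2 == Some s
     end].

(** A visit inside [f.2 p] is paid for by a strict drop of the rank [f.1]; a visit outside it leads
    back to [p]. *)
Definition targets f p s : {set track} :=
  if s \in f.2 p then [set q | f.1 q < f.1 p] else [set p].

Definition gadget f (e : track * track) : seq letter :=
  [:: detour e.1 e.2; return_to e.2 (targets f e.1 e.2)].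

Definition gadgets f (es : seq (track * track)) := flatten (map (gadget f) es).

(* Every detour occurs twice, so that a run of a single word can stay at a
   track long enough to visit all states it may visit and then leave it. *)
Definition fool_word f := gadgets f (enum predT ++ enum predT).

Definition admissible f := forall p, p \notin f.2 p.

Lemma gadgets_cat f es1 es2 : gadgets f (es1 ++ es2) = gadgets f es1 ++ gadgets f es2.
Proof. by rewrite /gadgets map_cat flatten_cat. Qed.

Lemma size_fool_word f : 0 < N -> 0 < size (fool_word f).
Proof.
move=> N_gt0; rewrite /fool_word.
have : (Ordinal N_gt0, Ordinal N_gt0) \in enum (@predT (track * track)).
  by rewrite mem_enum.
by case: (enum _) => [|e es].
Qed.

(** The prefix [es'] serves the induction: it is peeled off gadget by gadget and replaced by a copy
    of the period when empty. *)
Lemma gadgets_lasso f a0 es es' m : 0 < size es -> exists p s,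
  lasso a0 (gadgets f es') (gadgets f es) m.*2 = detour p s /\
  lasso a0 (gadgets f es') (gadgets f es) m.*2.+1 = return_to s (targets f p s).
Proof.
move=> es_gt0; elim: m es' => [|m IHm] [|e es'].
- rewrite /= !lasso_nil; case: es es_gt0 => // e es _; by exists e.1, e.2.
- by exists e.1, e.2.
- have [p [s]] := IHm (behead es); rewrite /= !lasso_nil.
  case: es es_gt0 {IHm} => // e es _ h; exists p, s.
  by rewrite doubleS /= !lasso_consS.
- have [p [s]] := IHm es'; exists p, s.
  by rewrite doubleS /= !lasso_consS.
Qed.

(** [None] has no exit along a [detour], so [x] is a track: it is [p] idling, [p] visiting [s], [s]
    stepping aside, or another idle track. Idling is harmless because [f] is admissible. *)
Lemma gadget_step f p s (x y z : option track) : admissible f ->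
  (x, z) \in detour p s -> (z, y) \in return_to s (targets f p s) ->
  exists x' y' : track, [/\ x = Some x', y = Some y' &
    f.1 y' < f.1 x' \/ y' = x' /\ forall s', z = Some s' -> s' \notin f.2 x'].
Proof.
move=> adm; rewrite !inE /=; case: x => [x|] //.
case: (eqVneq x p) => [->|neq_xp].
  case/orP=> /eqP ->.
    case: eqVneq => [<-|_].
      case/imsetP=> y' + ->; rewrite /targets (negbTE (adm p)) inE => /eqP ->.
      by exists p, p; split=> //; right; split=> // s' [<-].
    by move=> /eqP ->; exists p, p; split=> //; right; split=> // s' [<-].
  rewrite eqxx => /imsetP[y' + ->]; rewrite /targets.
  case: ifPn => [_|ns]; rewrite inE.
    by move=> lt; exists p, y'; split=> //; left.
  by move=> /eqP ->; exists p, p; split=> //; right; split=> // s' [<-].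
case: (eqVneq x s) => [->|neq_xs] /eqP ->.
  by move=> /eqP ->; exists s, s; split=> //; right; split.
rewrite (negbTE neq_xs) => /eqP ->.
by exists x, x; split=> //; right; split=> // s' [<-].
Qed.

(* The rank [f.1] of the track at the even positions of a run cannot increase,
   so it is eventually constant, and from then on [f.2 p] is avoided, where [p]
   is the limit track. *)
Lemma fool_word_rejecting f a0 rho : 0 < N -> admissible f ->
  is_run (A := full_automaton) (lasso a0 [::] (fool_word f)) rho ->
  exists p, forall s, s \in f.2 p -> ~ Inf rho (Some s).
Proof.
move=> N_gt0 adm [_ step].
have es_gt0 : 0 < size (enum (@predT (track * track)) ++ enum predT).
  move: (size_fool_word f N_gt0); rewrite /fool_word.
  by case: (_ ++ _).
have stepm m : exists x' y' : track, [/\ rho m.*2 = Some x', rho m.+1.*2 = Some y' &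
    f.1 y' < f.1 x' \/ y' = x' /\ forall s', rho m.*2.+1 = Some s' -> s' \notin f.2 x'].
  have [p [s [e1 e2]]] := gadgets_lasso f a0 [::] m es_gt0.
  apply: (@gadget_step _ p s) => //.
    by have := step m.*2; rewrite [lasso _ _ _ _]e1 inE.
  by have := step m.*2.+1; rewrite [lasso _ _ _ _]e2 inE doubleS.
have /choice[x hx] m : exists x : track, rho m.*2 = Some x.
  by have [x' [_ [-> _ _]]] := stepm m; exists x'.
have {}stepm m : f.1 (x m.+1) < f.1 (x m) \/ x m.+1 = x m /\
    forall s', rho m.*2.+1 = Some s' -> s' \notin f.2 (x m).
  by have [x' [y' []]] := stepm m; rewrite !hx => -[<-] [<-].
have [m0 min_m0] : exists m0, forall m, f.1 (x m0) <= f.1 (x m).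
  have ex : exists v, `[< exists m, f.1 (x m) = v :> nat >].
    by exists (f.1 (x 0)); apply/asboolP; exists 0.
  case: (ex_minnP ex) => v /asboolP[m0 <-] min_v.
  by exists m0 => m; apply: min_v; apply/asboolP; exists m.
have const m : m0 <= m -> x m = x m0.
  elim: m => [|m IHm]; first by rewrite leqn0 => /eqP ->.
  rewrite leq_eqVlt => /predU1P[<- //|]; rewrite ltnS => /IHm eqm.
  have [|[-> //]] := stepm m.
  by rewrite eqm ltnNge min_m0.
exists (x m0) => s s_in /(_ m0.*2)[j le_j].
have le_m : m0 <= j./2 by rewrite -(doubleK m0) half_leq.
(* Odd positions are midpoints of gadgets, covered by [stepm]; even ones carry the limit track,
   which admissibility keeps outside its own set. *)
rewrite -[j]odd_double_half; case: (odd j) => /=.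
  move=> rj; have [|[_ /(_ s rj)]] := stepm j./2.
    by rewrite !const ?ltnn // leqW.
  by rewrite const // s_in.
by rewrite add0n hx const // => -[xs]; have := adm s; rewrite -{2}xs s_in.
Qed.

(** In a gadget of another track, [p] idles or steps aside through [None]; in its own, it visits [s]
    when that visit is free. *)
Lemma stay_gadget f p e : admissible f -> exists z : option track,
  fits (A := full_automaton) (Some p) (gadget f e) [:: z; Some p] /\
  (e.1 = p -> e.2 \notin f.2 p -> z = Some e.2).
Proof.
move=> adm; case: e => p' s /=.
case: (eqVneq p p') => [<-|neq]; last first.
  exists (if p == s then None else Some p); split; last first.
    by move=> eq_p; rewrite eq_p eqxx in neq.
  rewrite !inE /= (negbTE neq) andbT.
  by case: (eqVneq p s) => [->|ne_ps]; rewrite ?eqxx ?(negbTE ne_ps).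
case: (boolP (s \in f.2 p)) => s_in.
  exists (Some p); split=> //; rewrite !inE /= !eqxx /= andbT.
  by case: eqVneq s_in => // <-; rewrite (negbTE (adm p)).
exists (Some s); split=> //; rewrite !inE /= !eqxx orbT /= andbT.
by rewrite /targets (negbTE s_in); apply: imset_f; rewrite inE.
Qed.

Lemma stay_gadgets f p es : admissible f -> exists r : seq (option track),
  [/\ fits (A := full_automaton) (Some p) (gadgets f es) r, last (Some p) r = Some p &
    forall s, (p, s) \in es -> s \notin f.2 p -> Some s \in r].
Proof.
move=> adm; elim: es => [|e es [r [fit_r last_r vis_r]]]; first by exists [::].
have [z [fit_z vis_z]] := stay_gadget p e adm.
exists ([:: z; Some p] ++ r); split=> //.
  by apply: (fits_cat (x := Some p : state full_automaton) fit_z).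
move=> s; rewrite in_cons => /predU1P[eq_e|es_s] ns.
  by rewrite -eq_e in vis_z; rewrite mem_cat in_cons (vis_z _ ns) ?eqxx.
by rewrite mem_cat vis_r ?orbT.
Qed.

Lemma stay_word f p : admissible f -> exists r : seq (option track),
  [/\ fits (A := full_automaton) (Some p) (fool_word f) r, last (Some p) r = Some p &
    forall s, s \notin f.2 p -> Some s \in r].
Proof.
move=> adm; have [r [h1 h2 h3]] := stay_gadgets p (enum predT ++ enum predT) adm.
by exists r; split=> // s; apply: h3; rewrite mem_cat mem_enum.
Qed.

Lemma stay_words f p m : admissible f -> exists r : seq (option track),
  fits (A := full_automaton) (Some p) (flatten (nseq m (fool_word f))) r /\
  last (Some p) r = Some p.
Proof.
move=> adm; elim: m => [|m [r [fit_r last_r]]]; first by exists [::].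
have [r' [fit_r' last_r' _]] := stay_word p adm.
exists (r' ++ r); rewrite last_cat last_r'; split=> //.
by apply: fits_cat => //; rewrite last_r'.
Qed.

(** The first enumeration of gadgets makes all free visits from [p]. In the second, the run waits
    for the gadget of [(p, s)], visits [s], drops to [q] and stays there. *)
Lemma jump_word f p q s : admissible f -> s \in f.2 p -> f.1 q < f.1 p ->
  exists r : seq (option track),
  [/\ fits (A := full_automaton) (Some p) (fool_word f) r, last (Some p) r = Some q &
    forall s', s' = s \/ s' \notin f.2 p -> Some s' \in r].
Proof.
move=> adm s_in lt_qp.
have [r0 [fit0 last0 vis0]] := stay_gadgets p (enum predT) adm.
have [es1 [es2 def_es]] : exists es1 es2,
    enum (@predT (track * track)) = es1 ++ (p, s) :: es2.
  have : (p, s) \in enum (@predT (track * track)) by rewrite mem_enum.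
  by case/splitPr => es1 es2; exists es1, es2.
have [r1 [fit1 last1 _]] := stay_gadgets p es1 adm.
have [r2 [fit2 last2 _]] := stay_gadgets q es2 adm.
exists (r0 ++ r1 ++ [:: Some s; Some q] ++ r2); split.
- rewrite /fool_word gadgets_cat; apply: fits_cat => //; rewrite last0.
  rewrite def_es gadgets_cat; apply: fits_cat => //; rewrite last1.
  apply: (fits_cat (A := full_automaton) (w1 := gadget f (p, s))) => //.
  rewrite /= !inE /= !eqxx orbT /= andbT /targets s_in.
  by apply: imset_f; rewrite inE.
- by rewrite !last_cat.
- move=> s' [->|ns]; rewrite !mem_cat; first by rewrite in_cons eqxx !orbT.
  by rewrite vis0 // mem_enum.
Qed.

End Words.

(** A permutation is determined by its order, its value at [p] being the number of elements ranked
    below [p]. Hence distinct permutations order some pair oppositely. *)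
Lemma perm_order_inj n (sigma tau : 'S_n) :
  (forall p q, sigma q < sigma p -> tau q <= tau p) -> sigma = tau.
Proof.
move=> h.
have card_below (pi : 'S_n) p : #|[set q | pi q < pi p]| = pi p.
  have -> : [set q | pi q < pi p] = pi @^-1: [set j : 'I_n | j < pi p].
    by apply/setP => q; rewrite !inE.
  rewrite card_preimset; last exact: perm_inj.
  rewrite -sum1dep_card -(big_ord_widen n (fun=> 1)) ?sum1_card ?card_ord //.
  exact: ltnW.
apply/permP => p; apply: val_inj; rewrite /= -(card_below sigma) -(card_below tau); congr #|pred_of_set _|.
apply/setP => q; rewrite !inE; apply/idP/idP => lt_qp.
  rewrite ltn_neqAle h // andbT; apply: contraTneq lt_qp => /val_inj/perm_inj ->.
  by rewrite ltnn.
rewrite ltnNge; apply/negP; rewrite leq_eqVlt => /predU1P[|/h].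
  by move=> /val_inj/perm_inj eq_pq; rewrite eq_pq ltnn in lt_qp.
by rewrite leqNgt lt_qp.
Qed.

(** * Rejected pure words and accepted mixed words *)

Section Mixing.
Variables (N : nat) (Fam : {set {set 'I_N}}).
Hypothesis Fam_neq0 : forall F, F \in Fam -> 0 < #|F|.
Hypothesis Fam_antichain : forall F G, F \in Fam -> G \in Fam -> F \subset G -> F = G.

Definition fool_index : {pred 'S_N * {ffun 'I_N -> {set 'I_N}}} :=
  [pred f | f.2 \in family (fun p => [pred F in Fam | p \notin F])].

Lemma fool_indexP f : f \in fool_index ->
  admissible f /\ forall p, f.2 p \in Fam.
Proof.
by move=> /familyP h; split=> p; have := h p; rewrite inE => /andP[].
Qed.

Definition fool_ngbw : NGBW _ :=
  @MkNGBW _ (full_automaton N) [set Some @: F | F : {set 'I_N} in Fam].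

Lemma card_ngbw_acc : #|ngbw_acc fool_ngbw| = #|Fam|.
Proof. by rewrite card_imset //; apply: imset_inj => ? ? []. Qed.

Lemma fool_word_notin f a0 : 0 < N -> f \in fool_index ->
  ~ ngbw_lang fool_ngbw (lasso a0 [::] (fool_word f)).
Proof.
move=> N_gt0 /fool_indexP[adm f_in] [rho runP succ].
have [p hp] := fool_word_rejecting N_gt0 adm runP.
have [|y []] := succ (Some @: f.2 p); first by rewrite /= imset_f.
by move=> Iy /= /imsetP[s s_in eq_y]; apply: (hp s s_in); rewrite -eq_y.
Qed.

Lemma mixed_fool_word_in f g a0 m a b : f \in fool_index -> g \in fool_index ->
  f != g ->
  ngbw_lang fool_ngbw (lasso a0 (flatten (nseq m (fool_word f)))
    (flatten (nseq a.+1 (fool_word f)) ++ flatten (nseq b.+1 (fool_word g)))).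
Proof.
move=> /fool_indexP[admf f_in] /fool_indexP[admg g_in] neq_fg.
(* One copy of each word suffices: the surplus copies are read while staying at [p] or [q]. *)
suff [p [q [r1 [r2 [[fit1 last1] [fit2 last2] vis]]]]] : exists p q (r1 r2 : seq (option 'I_N)),
  [/\ fits (A := full_automaton N) (Some p) (fool_word f) r1 /\ last (Some p) r1 = Some q,
      fits (A := full_automaton N) (Some q) (fool_word g) r2 /\ last (Some q) r2 = Some p &
      forall F, F \in Fam -> exists2 s, s \in F & Some s \in r1 ++ r2].
  have [r0 [fit0 last0]] := stay_words p m admf.
  have [r3 [fit3 last3]] := stay_words q a admf.
  have [r4 [fit4 last4]] := stay_words p b admg.
  have [||||rho runP infP] := lasso_run (A := full_automaton N) a0
    (x := Some p) (q := Some p) (u := flatten (nseq m (fool_word f)))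
    (v := flatten (nseq a.+1 (fool_word f)) ++ flatten (nseq b.+1 (fool_word g)))
    (r1 := r0) (r2 := (r1 ++ r3) ++ (r2 ++ r4)) _ fit0 last0.
  - by rewrite inE.
  - by rewrite !size_cat !addn_gt0 size_fool_word // (leq_ltn_trans _ (ltn_ord p)).
  - apply: fits_cat; first by apply: fits_cat => //; rewrite last1.
    by rewrite last_cat last1 last3; apply: fits_cat => //; rewrite last2.
  - by rewrite !last_cat last1 last3 last2.
  exists rho => // _ /imsetP[F F_in ->]; have [s s_F s_r] := vis F F_in.
  exists (Some s); split; last exact: imset_f.
  rewrite infP /=; move: s_r; rewrite !mem_cat.
  by case/orP=> ->; rewrite ?orbT.
(* With equal choices the permutations differ, so a run can drop from [p] to [q] along [f] and from
   [q] to [p] along [g]. The first drop visits [f.2 p] and, by the antichain property, every other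
   member of [Fam]. *)
case: (eqVneq f.2 g.2) => [eq2|/eqP neq2].
  have neq1 : f.1 <> g.1.
    move=> eq1; case/eqP: neq_fg; case: f g eq1 eq2 {admf admg f_in g_in} => ? ? [? ?] /=.
    by move=> -> ->.
  have [p [q [ltf ltg]]] : exists p q, f.1 q < f.1 p /\ g.1 p < g.1 q.
    apply: contrapT => no; apply: neq1; apply: perm_order_inj => p q lt_qp.
    by rewrite leqNgt; apply/negP => lt_pq; apply: no; exists p, q.
  have /card_gt0P[s s_in] := Fam_neq0 (f_in p).
  have /card_gt0P[s' s'_in] := Fam_neq0 (g_in q).
  have [r1 [fit1 last1 vis1]] := jump_word admf s_in ltf.
  have [r2 [fit2 last2 _]] := jump_word admg s'_in ltg.
  exists p, q, r1, r2; split=> // F F_in.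
  case: (eqVneq F (f.2 p)) => [->|neqF].
    by exists s => //; rewrite mem_cat vis1 //; left.
  have /subsetPn[t tF tn] : ~~ (F \subset f.2 p).
    by apply: contraNN neqF => /(Fam_antichain F_in (f_in p)) ->.
  by exists t => //; rewrite mem_cat vis1 //; right.
(* Staying at [p] is enough: each [F] differs from [f.2 p] or [g.2 p], so it has an element that is
   visited for free. *)
have [p neq_p] : exists p, f.2 p != g.2 p.
  apply: contrapT => /forallNP no; apply: neq2; apply/ffunP => p.
  by apply/eqP; apply: contrapT => /negP /no.
have [r1 [fit1 last1 vis1]] := stay_word p admf.
have [r2 [fit2 last2 vis2]] := stay_word p admg.
exists p, p, r1, r2; split=> // F F_in.
have [neqF|neqF] : F != f.2 p \/ F != g.2 p.
  by case: (eqVneq F (f.2 p)) => [->|]; [right|left].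
- have /subsetPn[t tF tn] : ~~ (F \subset f.2 p).
    by apply: contraNN neqF => /(Fam_antichain F_in (f_in p)) ->.
  by exists t => //; rewrite mem_cat vis1.
- have /subsetPn[t tF tn] : ~~ (F \subset g.2 p).
    by apply: contraNN neqF => /(Fam_antichain F_in (g_in p)) ->.
  by exists t => //; rewrite mem_cat vis2 ?orbT.
Qed.

End Mixing.

(** * State bounds for Streett and deterministic Rabin automata *)

Section FoolingAcceptance.
Variables (Sigma I : finType) (a0 : Sigma) (w : I -> seq Sigma).
Hypothesis w_gt0 : forall i, 0 < size (w i).

Definition mixed_word i j m a b : nat -> Sigma :=
  lasso a0 (flatten (nseq m (w i)))
    (flatten (nseq a.+1 (w i)) ++ flatten (nseq b.+1 (w j))).

Lemma nsw_fooling (B : NSW Sigma) :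
  (forall i, nsw_lang B (lasso a0 [::] (w i))) ->
  (forall i j m a b, i != j -> ~ nsw_lang B (mixed_word i j m a b)) ->
  #|I| <= #|state B|.
Proof.
move=> acc rej; apply: (fooling_set w_gt0 _ acc rej) => X Y sX sY G' B' acc_GB.
move=> [x [[Xx|Yx] B'x]].
  by have [|y [Xy G'y]] := sX G' B' acc_GB; [exists x | exists y; split; [left|]].
by have [|y [Yy G'y]] := sY G' B' acc_GB; [exists x | exists y; split; [right|]].
Qed.

Lemma det_run_agree (A : automaton Sigma) alpha alpha' rho rho' t :
  deterministic A -> is_run (A := A) alpha rho -> is_run (A := A) alpha' rho' ->
  (forall i, i < t -> alpha i = alpha' i) -> rho t = rho' t.
Proof.
move=> [init1 det] [i0 step] [i0' step']; elim: t => [|t IHt] agree.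
  by move/eqP/cards1P: init1 i0 i0' => [q ->]; rewrite !inE => /eqP -> /eqP ->.
have eq_t := IHt (fun i lt_it => agree i (ltnW lt_it)).
by apply: (det _ _ _ _ (step t)); rewrite eq_t agree.
Qed.

(** The automaton may be incomplete, so a run could block. Runs on words sharing longer and longer
    prefixes with [alpha] agree by determinism, and their diagonal is the run. *)
Lemma det_run_exists (A : automaton Sigma) alpha : deterministic A ->
  (forall t, exists alpha' rho, is_run (A := A) alpha' rho /\
     forall i, i < t -> alpha' i = alpha i) ->
  exists rho, is_run (A := A) alpha rho.
Proof.
move=> det /choice[al /choice[r hr]]; exists (fun t => r t t).
split=> [|t]; first by case: (hr 0) => -[].
have [run_t agree_t] := hr t; have [run_St agree_St] := hr t.+1.
have -> : r t t = r t.+1 t.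
  apply: (det_run_agree det run_t run_St) => i lt_it.
  by rewrite agree_t // agree_St // ltnW.
by rewrite -agree_St //; apply: (proj2 run_St).
Qed.

(** Runs being unique, the dual Streett condition on the same automaton rejects the mixed words. It
    accepts the pure ones, on which a run exists because accepted mixed words share arbitrarily long
    prefixes with them. *)
Lemma drw_fooling (B : DRW Sigma) :
  (forall i, ~ drw_lang B (lasso a0 [::] (w i))) ->
  (forall i j m a b, i != j -> drw_lang B (mixed_word i j m a b)) ->
  #|I| <= #|state B|.
Proof.
move=> rej acc; have det := drw_det B.
(* With at most one index there is no mixed word to supply runs, but the initial state already gives
   the bound. *)
have [le_I1|/card_gt1P[i1 [i2 [_ _ neq12]]]] := leqP #|I| 1.
  apply: leq_trans le_I1 _; case: det => init1 _.
  by rewrite -init1 max_card.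
pose success (X : set (state B)) := forall G' B', (G', B') \in drw_acc B ->
  (X `&` [set` G'] !=set0 -> X `&` [set` B'] !=set0)%classic.
apply: (@fooling_set _ B success _ a0 _ w_gt0).
- move=> X Y sX sY G' B' acc_GB [x [[Xx|Yx] B'x]].
    by have [|y [Xy G'y]] := sX G' B' acc_GB; [exists x | exists y; split; [left|]].
  by have [|y [Yy G'y]] := sY G' B' acc_GB; [exists x | exists y; split; [right|]].
- move=> i; have [j neq_ij] : exists j, i != j.
    by case: (eqVneq i i1) => [->|]; [exists i2 | exists i1].
  have [rho runP] : exists rho, is_run (A := B) (lasso a0 [::] (w i)) rho.
    apply: det_run_exists => // t.
    have [rho runP _] := acc i j t 0 0 neq_ij.
    exists (mixed_word i j t 0 0), rho; split=> // l lt_lt.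
    by apply: lasso_rep; apply: leq_trans lt_lt _; rewrite leq_pmulr.
  exists rho => // G' B' acc_GB meetG; apply: contrapT => nB.
  apply: (rej i); exists rho => //; exists G', B'; split=> //.
  by apply/eqP; apply: contrapT => /negP /set0P.
- move=> i j m a b neq_ij [rho runP succ].
  have [rho' runP' [G' [B' [acc_GB meetG missB]]]] := acc i j m a b neq_ij.
  have eq_rho : rho = rho' by apply/funext => t; apply: (det_run_agree det runP runP').
  by have := succ G' B' acc_GB; rewrite eq_rho missB => /(_ meetG)[x []].
Qed.

End FoolingAcceptance.

(** * Balanced antichains and counting *)

Section Balanced.
Variable T : finType.
Implicit Types (Fam : {set {set T}}) (F : {set T}) (p q x : T).

Definition degree Fam x := \sum_(F in Fam) (x \in F).

Lemma subset_of_card (U : finType) (A : {set U}) k : k <= #|A| ->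
  exists2 B : {set U}, B \subset A & #|B| = k.
Proof.
rewrite -bin_gt0 -cards_draws => /card_gt0P[B].
by rewrite inE => /andP[sBA /eqP cardB]; exists B.
Qed.

(** Both corrections are added, which avoids truncated subtraction. *)
Lemma degree_exchange Fam F F' x : F \in Fam -> F' \notin Fam ->
  degree (F' |: (Fam :\ F)) x + (x \in F) = degree Fam x + (x \in F').
Proof.
move=> F_in F'_out; rewrite /degree big_setU1 /=; last first.
  by rewrite !inE negb_and F'_out orbT.
by rewrite [in RHS](big_setD1 F) //= -addnA addnC; congr (_ + _); apply: addnC.
Qed.

(* A family minimizing the sum of the squared degrees is balanced: otherwise
   replace [p] by [q] in a member. *)
Lemma balanced_family h k : k <= 'C(#|T|, h) -> exists Fam : {set {set T}},
  [/\ #|Fam| = k, forall F, F \in Fam -> #|F| = h &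
    forall p q, degree Fam p <= (degree Fam q).+1].
Proof.
move=> le_k.
pose P Fam := (#|Fam| == k) && [forall F in Fam, #|F| == h].
have [Fam0 P0] : exists Fam0, P Fam0.
  have [|Fam0 sub0 card0] := @subset_of_card _ [set F : {set T} | #|F| == h] k.
    by rewrite card_draws.
  exists Fam0; rewrite /P card0 eqxx /=; apply/forall_inP => F /(fintype.subsetP sub0).
  by rewrite inE.
case: (arg_minnP (fun Fam => \sum_x (degree Fam x) ^ 2) P0) => Fam.
move=> /andP[/eqP cardF /forall_inP szF] minF.
exists Fam; split=> // [F /szF/eqP //|p q].
rewrite leqNgt; apply/negP => lt_qp.
have neq_pq : p != q by apply: contraTneq lt_qp => ->; rewrite ltnNge leqW.
pose sw F := q |: (F :\ p).
pose A := [set F in Fam | (p \in F) && (q \notin F)].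
pose B := [set F in Fam | (q \in F) && (p \notin F)].
(* Members containing both points cancel in the difference of the degrees of [p] and [q]. *)
have lt_BA : #|B| < #|A|.
  have e (a b : T) : degree Fam a = \sum_(F in Fam) ((a \in F) && (b \in F))
      + \sum_(F in Fam) ((a \in F) && (b \notin F)).
    rewrite -big_split /=; apply: eq_bigr => F _.
    by case: (a \in F); case: (b \in F).
  have eA (a b : T) : #|[set F in Fam | (a \in F) && (b \notin F)]|
      = \sum_(F in Fam) ((a \in F) && (b \notin F)).
    rewrite -sum1_card big_mkcond [RHS]big_mkcond /=; apply: eq_bigr => F _.
    by rewrite inE; case: (F \in Fam) => //=; case: (_ && _).
  rewrite /A /B !eA; move: lt_qp; rewrite (e p q) (e q p).
  under [X in _ < X + _ -> _]eq_bigr => F _ do rewrite andbC.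
  lia.
have sw_inj : {in A &, injective sw}.
  move=> F F'; rewrite !inE => /and3P[_ pF qF] /and3P[_ pF' qF'] /setP eq_sw.
  apply/setP => x; have := eq_sw x; rewrite !inE.
  case: (eqVneq x q) => [->|_] /=; first by rewrite (negbTE qF) (negbTE qF').
  by case: (eqVneq x p) => [->|_] //=; rewrite pF pF'.
(* [sw] is injective on [A], which is larger than [B], so some swapped set is new to [Fam]. *)
have /subsetPn[_ /imsetP[F FA ->] nB] : ~~ (sw @: A \subset B).
  by apply/negP => /subset_leq_card; rewrite card_in_imset // leqNgt lt_BA.
move: FA; rewrite inE => /and3P[F_in pF qF].
have sw_q : q \in sw F by rewrite setU11.
have sw_p : p \notin sw F by rewrite !inE eqxx andFb orbF.
have sw_out : sw F \notin Fam.
  by apply: contra nB => sw_in; rewrite inE sw_in sw_q sw_p.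
pose Fam' := sw F |: (Fam :\ F).
have deg' x : degree Fam' x + (x \in F) = degree Fam x + (x \in sw F).
  exact: degree_exchange.
have PF' : P Fam'.
  apply/andP; split.
    rewrite cardsU1 !inE negb_and sw_out orbT.
    by have := cardsD1 F Fam; rewrite F_in cardF => ->.
  apply/forall_inP => F'; rewrite in_setU1 in_setD1 => /predU1P[->|/andP[_ /szF]//].
  rewrite cardsU1 !inE (negbTE qF) andbF /= -(eqP (szF F F_in)).
  by rewrite (cardsD1 p F) pF.
(* Only two degrees change, [d1] to [d1 - 1] and [d2] to [d2 + 1]; as [d1 >= d2 + 2], the sum of
   squares drops. *)
have := minF Fam' PF'; apply/negP; rewrite -ltnNge.
rewrite (bigD1 p) //= (bigD1 q) 1?eq_sym //= [ltnRHS](bigD1 p) //=.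
rewrite [X in _ < _ + X](bigD1 q) 1?eq_sym //=.
rewrite [X in _ + (_ + X) < _](eq_bigr (fun x => degree Fam x ^ 2)); last first.
  move=> x /andP[neq_xp neq_xq]; congr (_ ^ 2); have := deg' x.
  by rewrite !inE neq_xp (negbTE neq_xq) /= => /addIn.
have := deg' p; have := deg' q; rewrite sw_q (negbTE sw_p) pF (negbTE qF) /=.
by move: lt_qp; move: (degree Fam p) (degree Fam q) => d1 d2; nia.
Qed.

(** The average degree is at most [k / 2] and the degree of [p] is less than one above it, so at
    least [(k - 1) / 2] members avoid [p], which is at least [k / 4] once [k > 1]. *)
Lemma card_avoiding Fam h k p : 1 < k -> 2 * h <= #|T| ->
  #|Fam| = k -> (forall F, F \in Fam -> #|F| = h) ->
  (forall p q, degree Fam p <= (degree Fam q).+1) ->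
  k <= 4 * #|[pred F in Fam | p \notin F]|.
Proof.
move=> k_gt1 le_h cardF szF bal.
have sum_deg : \sum_x degree Fam x = k * h.
  rewrite exchange_big /= -cardF -sum_nat_const; apply: eq_bigr => F F_in.
  by rewrite -(szF F F_in) -sum1_card [RHS]big_mkcond.
have deg_avoid : degree Fam p + #|[pred F in Fam | p \notin F]| = k.
  rewrite -cardF -!sum1_card big_mkcondr -big_split /=.
  by apply: eq_bigr => F _; case: (p \in F).
(* Strict because of the summand at [p] itself; the case [k = 2] needs this. *)
have : #|T| * degree Fam p < \sum_x (degree Fam x).+1.
  rewrite -sum_nat_const (bigD1 p) //= [ltnRHS](bigD1 p) //= -addSn leq_add //.
  exact: leq_sum.
under eq_bigr => x _ do rewrite -addn1.
rewrite big_split /= sum_deg sum1_card => lt.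
suff: 2 * degree Fam p < k + 2.
  move: deg_avoid k_gt1; move: (degree _ _) (#|_|) => d a; lia.
rewrite -(@ltn_pmul2l #|T|); last by apply/card_gt0P; exists p.
have := leq_mul (leqnn k) le_h; move: lt; move: (degree _ _) (#|T|) => d t; nia.
Qed.

End Balanced.

(** * Counting the fooling words *)

Lemma bin_leq_exp2 n m : 'C(n, m) <= 2 ^ n.
Proof.
have := max_card [set A : {set 'I_n} | #|A| == m].
by rewrite card_draws card_ord -cardsT -powersetT card_powerset cardsT card_ord.
Qed.

(** Each factor of the falling factorial of [2n] of length [n] is at least [n], and the product is
    ['C(2n, n) * n!]. *)
Lemma exp_leq_fact n : n ^ n <= 4 ^ n * n`!.
Proof.
have le_ff : n ^ n <= (n + n) ^_ n.
  have -> : n ^ n = \prod_(i < n) n by rewrite prod_nat_const card_ord.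
  by rewrite ffact_prod; apply: leq_prod => i _; have := ltn_ord i; lia.
apply: leq_trans le_ff _; rewrite -bin_ffact leq_mul2r.
by apply/orP; right; rewrite -[4]/(2 ^ 2) -expnM mul2n -addnn bin_leq_exp2.
Qed.

Lemma card_fool_index N (Fam : {set {set 'I_N}}) k :
  (forall p, k <= 4 * #|[pred F in Fam | p \notin F]|) ->
  N`! * k ^ N <= 4 ^ N * #|fool_index Fam|.
Proof.
move=> hk.
have -> : #|fool_index Fam| =
    N`! * #|family (fun p : 'I_N => [pred F in Fam | p \notin F])|.
  rewrite -card_Sn -cardX; apply: eq_card => -[s i].
  by rewrite !inE.
rewrite mulnCA leq_mul2l card_family; apply/orP; right.
suff le_seq (ps : seq 'I_N) : k ^ size ps <= 4 ^ size ps *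
    foldr muln 1 [seq #|[pred F in Fam | p \notin F]| | p <- ps].
  by have := le_seq (enum 'I_N); rewrite size_enum_ord.
elim: ps => //= p ps IH; rewrite !expnS mulnACA.
exact: leq_mul.
Qed.

(** Passing from [N! k^N] to [(n k)^n] costs [4^n] for the factorial, and [2^N] for each of the
    missing factors [n] and [k]. With the [4^N] of the hypothesis this stays below [64^n]. *)
Lemma lower_bound_arith n k N M : n = N.+1 -> k <= 2 ^ N ->
  N`! * k ^ N <= 4 ^ N * M -> (n * k) ^ n <= 64 ^ n * M.
Proof.
move=> -> le_k leM.
have h1 : N.+1 <= 2 ^ N by rewrite ltn_expl.
have h2 : N.+1 ^ N.+1 <= 4 ^ N.+1 * (2 ^ N * N`!).
  apply: leq_trans (exp_leq_fact _) _; rewrite factS.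
  by rewrite leq_mul2l leq_mul2r h1 !orbT.
have h3 : k ^ N.+1 <= 2 ^ N * k ^ N by rewrite expnS leq_mul2r le_k orbT.
rewrite expnMn; apply: leq_trans (leq_mul h2 h3) _.
have -> : 4 ^ N.+1 * (2 ^ N * N`!) * (2 ^ N * k ^ N)
    = 4 ^ N.+1 * (2 ^ N * 2 ^ N) * (N`! * k ^ N) by lia.
rewrite -expnMn -[2 * 2]/4.
apply: leq_trans (_ : 4 ^ N.+1 * 4 ^ N * (4 ^ N * M) <= _).
  by rewrite leq_mul2l leM orbT.
rewrite !mulnA leq_mul2r; apply/orP; right.
rewrite -[64]/(4 * 4 * 4) !expnMn.
by rewrite !leq_mul // leq_exp2l.
Qed.

(** * From generalized Buchi to Streett, and assembly of the bounds *)

(** Some state always recurs, so a pair whose [B] is the whole state set demands just that [F] be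
    met. *)
Definition streett_of_buchi (Sigma : finType) (A : NGBW Sigma) : NSW Sigma :=
  @MkNSW Sigma A [set (F, [set: state A]) | F in ngbw_acc A].

Lemma streett_of_buchi_lang (Sigma : finType) (A : NGBW Sigma) :
  nsw_lang (streett_of_buchi A) = ngbw_lang A.
Proof.
apply/seteqP; split=> alpha [rho runP succ]; exists rho => //.
  move=> F F_in; apply: (succ F [set: state A]); first exact: imset_f.
  by have [q Iq] := Inf_neq0 rho; exists q; split; rewrite //= inE.
by move=> G B /imsetP[F F_in [-> _]] _; apply: succ.
Qed.

Lemma card_streett_of_buchi (Sigma : finType) (A : NGBW Sigma) :
  #|nsw_acc (streett_of_buchi A)| = #|ngbw_acc A|.
Proof. by rewrite card_imset // => F G []. Qed.

Lemma hard_ngbw n k : 1 < n -> 1 < k <= 'C(n.-1, n.-1./2) ->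
  exists (Sigma : finType) (A : NGBW Sigma) M,
  [/\ #|state A| = n, #|ngbw_acc A| = k, (n * k) ^ n <= 64 ^ n * M,
      forall B : NSW Sigma, nsw_lang B = (~` ngbw_lang A)%classic -> M <= #|state B| &
      forall B : DRW Sigma, drw_lang B = ngbw_lang A -> M <= #|state B|].
Proof.
case: n => // N; rewrite ltnS /= => N_gt0 /andP[k_gt1 le_k].
have [|Fam [card_Fam size_F bal]] := @balanced_family 'I_N N./2 k.
  by rewrite card_ord.
(* Size zero would allow only one set, against [k > 1]. *)
have h_gt0 : 0 < N./2.
  rewrite lt0n; apply: contraTneq (leq_trans k_gt1 le_k) => ->.
  by rewrite bin0.
have Fam_gt0 F : F \in Fam -> 0 < #|F| by move/size_F ->.
have Fam_anti F G : F \in Fam -> G \in Fam -> F \subset G -> F = G.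
  by move=> F_in G_in sFG; apply/eqP; rewrite eqEcard sFG !size_F /=.
have avoid p : k <= 4 * #|[pred F in Fam | p \notin F]|.
  apply: (card_avoiding p k_gt1 _ card_Fam size_F bal).
  by rewrite card_ord mul2n -{2}[N]odd_double_half leq_addl.
exists _, (fool_ngbw Fam), #|fool_index Fam|.
pose I : finType := {f | f \in fool_index Fam}.
pose w (i : I) := fool_word (val i).
have w_gt0 i : 0 < size (w i) by apply: size_fool_word.
have cardI : #|I| = #|fool_index Fam| by rewrite card_sig; apply: eq_card.
have rej a0 (i : I) : ~ ngbw_lang (fool_ngbw Fam) (lasso a0 [::] (w i)).
  exact: fool_word_notin (valP i).
have acc a0 (i j : I) m a b : i != j ->
    ngbw_lang (fool_ngbw Fam) (mixed_word a0 w i j m a b).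
  by move=> neq_ij; apply: mixed_fool_word_in (valP i) (valP j) neq_ij.
split.
- by rewrite card_option card_ord.
- by rewrite card_ngbw_acc.
- apply: lower_bound_arith (card_fool_index avoid) => //.
  exact: leq_trans le_k (bin_leq_exp2 _ _).
(* The empty relation is a default letter, never read since the periods are nonempty. *)
- move=> B langB; rewrite -cardI; apply: (nsw_fooling (a0 := finset.set0) w_gt0).
    by move=> i; rewrite langB; apply: rej.
  by move=> i j m a b neq_ij; rewrite langB; apply; apply: acc.
- move=> B langB; rewrite -cardI; apply: (drw_fooling (a0 := finset.set0) w_gt0).
    by move=> i; rewrite langB; apply: rej.
  by move=> i j m a b neq_ij; rewrite langB; apply: acc.
Qed.

Import Order.TTheory GRing.Theory Num.Theory.

Local Open Scope ring_scope.

Theorem theorem5p11 (R : realType) :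
  exists2 c : R, 0 < c &
    forall n k : nat, (1 < n)%N -> (1 < k <= 'C(n.-1, n.-1./2))%N ->
      (((c * n%:R * k%:R) ^+ n)%:E <= C_NSW R n k)%E /\
      (((c * n%:R * k%:R) ^+ n)%:E <= D_NGBW_DRW R n k)%E.
Proof.
(* The inverse of the base in [lower_bound_arith]. *)
exists 64%:R^-1; first by rewrite invr_gt0 ltr0n.
move=> n k n_gt1 k_bounds.
have [Sigma [A [M [cardA cardacc le_M nswM drwM]]]] := hard_ngbw n_gt1 k_bounds.
have le_bound m : (M <= m)%N -> (((64%:R^-1 * n%:R * k%:R) ^+ n)%:E <= (m%:R : R)%:E)%E.
  move=> le_m; rewrite lee_fin -mulrA exprMn exprVn ler_pdivrMl; last first.
    by rewrite exprn_gt0 ?ltr0n.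
  rewrite -natrM -!natrX -natrM ler_nat (leq_trans le_M) //.
  by rewrite leq_mul2l le_m orbT.
split.
- apply: (@le_trans _ _ (min_nsw_states R (~` nsw_lang (streett_of_buchi A))%classic)).
    apply: le_ereal_inf_tmp => _ [B [langB ->]]; apply/le_bound/nswM.
    by rewrite langB streett_of_buchi_lang.
  apply: ereal_sup_ubound; exists Sigma, (streett_of_buchi A); split=> //.
  by rewrite card_streett_of_buchi.
- apply: (@le_trans _ _ (min_drw_states R (ngbw_lang A))).
    by apply: le_ereal_inf_tmp => _ [B [langB ->]]; apply/le_bound/drwM.
  by apply: ereal_sup_ubound; exists Sigma, A.
Qed.
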